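(* Under the model and assumptions (A1)--(A3), (B1)--(B6) in the context, let $\hat\theta_n^\phi$ be a minimum $\phi$-divergence estimator which is a BAN estimator of the parameter $\theta$ (with true value $\theta_0$), and let $v_1(\theta):=qZI(Q_\theta)$, $v_2(\theta):=qDI(Q_\theta)$ for $\theta\in\Theta$. If, for $i=1,2$, $v_i$ is differentiable at $\theta_0$ and $\nabla v_i(\theta_0)\neq\mathbf 0$, then the estimators $v_1(\hat\theta_n^\phi)$ and $v_2(\hat\theta_n^\phi)$ are asymptotically normal estimators of $qZI(Q_{\theta_0})$ and $qDI(Q_{\theta_0})$, respectively; namely, for $i=1,2$, $$\sqrt n\left(v_i(\hat\theta_n^\phi)-v_i(\theta_0)\right)\xrightarrow{d}\mathcal N\left(0,\ \nabla v_i(\theta_0)\,I_{\theta_0}^{-1}\,(\nabla v_i(\theta_0))^{\top}\right)$$ as $n\to\infty$, where $\nabla v_i(\theta_0)$ is a row vector.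
   Context: Model. $X_1,\ldots,X_n$ are iid nonnegative random variables with cumulative distribution function $F_{\theta_0}$, an element of a family $\{F_\theta:\theta\in\Theta\}$, $\Theta\subset\mathbb{R}^s$. Let $0=c_0<c_1<\cdots<c_{k-1}<c_k=\infty$ be fixed, so that $[0,c_1),[c_1,c_2),\ldots,[c_{k-1},\infty)$ is a partition of $[0,\infty)$ into $k$ intervals, with $k>s+1$. Only the interval containing each $X_j$ is observed. Let $g(\theta)=(g_1(\theta),\ldots,g_k(\theta))$, $g_i(\theta)=F_\theta(c_i)-F_\theta(c_{i-1})$ (with $F_\theta(\infty)=1$), and $\Delta_k=\{(p_1,\ldots,p_k): p_i\ge 0,\ \sum_{i=1}^k p_i=1\}$. Let $\Pi_0=g(\Theta)\subset\Delta_k$. Let $P=(p_1,\ldots,p_k)$ be the vector of observed frequencies, $p_i=\frac1n\sum_{j=1}^n \mathbf{1}\{X_j\in[c_{i-1},c_i)\}$. Assumptions. (A1) For every $\theta\in\Theta$, $F_\theta$ is absolutely continuous and strictly increasing on $[0,\infty)$, and $F_\theta(0)=0$. (A2) The true value $\theta_0$ of the $s$-dimensional parameter is an interior point of $\Theta$, which is a compact subset of $\mathbb{R}^s$. (A3) For every $p\in(0,1)$, $Q_\theta(p)=F_\theta^{-1}(p)$ is a continuous function of $\theta$. (B1) $g_i(\theta_0)>0$ for $i=1,\ldots,k$. (B2) $g:\Theta\to\Delta_k$ is totally differentiable at $\theta_0$: the partial derivatives of each $g_i$ with respect to each $\theta_j$ exist at $\theta_0$ and $g(\theta)=g(\theta_0)+\frac{\partial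 g(\theta_0)}{\partial\theta}(\theta-\theta_0)+o(\|\theta-\theta_0\|)$ as $\theta\to\theta_0$, where $\frac{\partial g(\theta_0)}{\partial\theta}$ is the $k\times s$ matrix with $(i,j)$ entry $\frac{\partial g_i(\theta_0)}{\partial\theta_j}$. (B3) The Jacobian matrix $\frac{\partial g(\theta_0)}{\partial\theta}$ has full rank $s$. (B4) The inverse mapping $g^{-1}:\Pi_0\to\Theta$ (assumed to exist) is continuous at $g(\theta_0)$. (B5) $g:\Theta\to\Delta_k$ is continuous at every $\theta\in\Theta$. (B6) $g$ has continuous second partial derivatives in a neighbourhood of $\theta_0$. Estimators. A minimum $\phi$-divergence estimator $\hat\theta_n^\phi$ is a $\Theta$-valued estimator based on the sample of size $n$ with $\hat\theta_n^\phi\in\operatorname{arg\,min}_{\theta\in\Theta} d_\phi(P,g(\theta))$, where $d_\phi(P,g(\theta))=\sum_{i=1}^k g_i(\theta)\,\phi\left(\frac{p_i}{g_i(\theta)}\right)$ for a continuous convex $\phi:[0,\infty)\to\mathbb{R}\cup\{\infty\}$ with $\phi(1)=0$, $0\phi(0/0)=0$, $0\phi(t/0)=t\lim_{u\to\infty}\phi(u)/u$ for $t>0$. It is BAN (best asymptotically normal) if it is asymptotically normal and asymptotically efficient, i.e. $\sqrt n(\hat\theta_n^\phi-\theta_0)\xrightarrow{d}\mathcal N(\mathbf 0,I_{\theta_0}^{-1})$, where $I_{\theta}$ is the Fisher information matrix of the multinomial model with $k$ cells and cell probabilities $g(\theta)$, so $I_{\theta_0}=\left(\frac{\partial g(\theta_0)}{\partial\theta}\right)^{\top}\mathrm{diag}\left(\frac{1}{g_1(\theta_0)},\ldots,\frac1{g_k(\theta_0)}\right)\frac{\partial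 g(\theta_0)}{\partial\theta}$. Inequality curves and indices. For $p\in(0,1)$, $qZ(p;Q_\theta)=1-\frac{Q_\theta(p/2)}{Q_\theta((1+p)/2)}$ and $qD(p;Q_\theta)=1-\frac{Q_\theta(p/2)}{Q_\theta(1-p/2)}$; moreover $qZ(0;Q_\theta)=qZ(1;Q_\theta)=1$, $qD(0;Q_\theta)=1$, $qD(1;Q_\theta)=0$. The indices are $qZI(Q_\theta)=\int_0^1 qZ(p;Q_\theta)\,dp$ and $qDI(Q_\theta)=\int_0^1 qD(p;Q_\theta)\,dp$. *)

(* Defs.v *)
From HB Require Import structures.
From mathcomp Require Import all_boot all_order all_algebra finmap.
From mathcomp Require Import all_classical all_reals all_analysis.
Set Implicit Arguments.
Unset Strict Implicit.
Unset Printing Implicit Defensive.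
Import Order.TTheory GRing.Theory Num.Theory.
Import numFieldNormedType.Exports.
Local Open Scope classical_set_scope.
Local Open Scope ring_scope.

Definition mutually_independent {d} {T : measurableType d} {R : realType}
    (P : probability T R) (X : nat -> {RV P >-> R}) : Prop :=
  forall (J : {fset nat}) (A : nat -> set R),
    (forall j, j \in J -> measurable (A j)) ->
    P (\bigcap_(j in [set` J]) (X j @^-1` A j)) =
    (\prod_(j <- J) P (X j @^-1` A j))%E.

Definition is_cdf {R : realType} (F : R -> R) : Prop :=
  exists mu : probability R R, forall x, mu `]-oo, x]%classic = (F x)%:E.

Definition absolutely_continuous_on {R : realType} (D : set R) (f : R -> R) :=
  forall e : R, 0 < e -> exists2 delta : R, 0 < delta &
    forall (n : nat) (a b : 'I_n -> R),
      (forall i, a i <= b i /\ `[a i, b i] `<=` D) ->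
      trivIset [set: 'I_n] (fun i => `]a i, b i[%classic) ->
      \sum_(i < n) (b i - a i) < delta ->
      \sum_(i < n) `|f (b i) - f (a i)| < e.

(* The inverse of F viewed as a function on [0, +oo[. *)
Definition quantile {R : realType} (F : R -> R) (p : R) : R :=
  pinv [set x : R | 0 <= x] F p.

Section laws.
Context {R : realType}.

(* The law N(m, v) with variance v; [normal_prob m 0] is not the Dirac mass
   at m, hence the case distinction. *)
Definition normal_law (m v : R) : set R -> \bar R :=
  if v == 0 then \d_m else normal_prob m (Num.sqrt v).

(* R^s with its Borel sigma-algebra. *)
Definition borel_rV (s : nat) := g_sigma_algebraType (@open 'rV[R]_s).

(* Multivariate normality through linear combinations, which also covers
   singular S: mu is N_s(m, S) iff the law under mu of each linear combination
   x |-> x u^T of the coordinates is N(m u^T, u S u^T). *)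
Definition is_multinormal (s : nat) (mu : probability (borel_rV s) R)
    (m : 'rV[R]_s) (S : 'M[R]_s) : Prop :=
  forall (u : 'rV[R]_s) (A : set R), measurable A ->
    mu [set x : 'rV[R]_s | A ((x *m u^T) 0 0)] =
    normal_law ((m *m u^T) 0 0) ((u *m S *m u^T) 0 0) A.

Context {d} {T : measurableType d} (P : probability T R).

Definition cvg_in_distribution (Y : nat -> T -> R) (mu : set R -> \bar R) :=
  (forall n, measurable_fun setT (Y n)) /\
  forall f : R -> R, continuous f -> (exists M, forall x, `|f x| <= M) ->
    'E_P[fun w => f (Y n w)]%E @[n --> \oo] --> (\int[mu]_x (f x)%:E)%E.

Definition cvg_in_distribution_rV (s : nat) (Y : nat -> T -> 'rV[R]_s)
    (mu : set (borel_rV s) -> \bar R) :=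
  (forall n, measurable_fun setT (Y n : T -> borel_rV s)) /\
  forall f : 'rV[R]_s -> R, continuous f -> (exists M, forall x, `|f x| <= M) ->
    'E_P[fun w => f (Y n w)]%E @[n --> \oo] --> (\int[mu]_x (f x)%:E)%E.

End laws.

Section calculus.
Context {R : realType} {s : nat}.

Definition partial (j : 'I_s) (f : 'rV[R]_s -> R) : 'rV[R]_s -> R :=
  fun t => 'D_(delta_mx 0 j) f t.

Definition has_partial (j : 'I_s) (f : 'rV[R]_s -> R) (t : 'rV[R]_s) : Prop :=
  derivable f t (delta_mx 0 j).

Definition grad (f : 'rV[R]_s -> R) (t : 'rV[R]_s) : 'rV[R]_s :=
  \row_j partial j f t.

(* Rows index the components of g; this is the transpose of ['J g t]. *)
Definition jac {k : nat} (g : 'rV[R]_s -> 'rV[R]_k) (t : 'rV[R]_s) :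
    'M[R]_(k, s) :=
  \matrix_(i, j) partial j (fun u => g u 0 i) t.

Definition continuous_second_partials {k : nat} (g : 'rV[R]_s -> 'rV[R]_k)
    (t0 : 'rV[R]_s) : Prop :=
  \forall t \near t0, forall (i : 'I_k) (j l : 'I_s),
    let gi := fun u => g u 0 i in
    [/\ has_partial j gi t, has_partial l (partial j gi) t &
        {for t, continuous (partial l (partial j gi))}].

(* Fisher information of the multinomial model with cell probabilities g. *)
Definition fisher_information {k : nat} (g : 'rV[R]_s -> 'rV[R]_k)
    (t : 'rV[R]_s) : 'M[R]_s :=
  (jac g t)^T *m diag_mx (\row_i (g t 0 i)^-1) *m jac g t.

End calculus.

Section grouped_data.
Context {R : realType}.

Definition cdf_ext (F : R -> R) (x : \bar R) : R :=
  match x with x%:E => F x | +oo%E => 1 | -oo%E => 0 end.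

Definition is_partition (k : nat) (c : nat -> \bar R) : Prop :=
  [/\ c 0%N = 0%E, c k = +oo%E &
      forall i, (i < k)%N -> (c i < c i.+1)%E].

Definition cell (c : nat -> \bar R) (i : nat) : set R :=
  [set x | (c i <= x%:E < c i.+1)%E].

Definition cell_probs (k : nat) (c : nat -> \bar R) (F : R -> R) : 'rV[R]_k :=
  \row_(i < k) (cdf_ext F (c i.+1) - cdf_ext F (c i)).

(* Frequencies of the cells among x 0, ..., x (n - 1). *)
Definition frequencies (k : nat) (c : nat -> \bar R) (n : nat) (x : nat -> R) :
    'rV[R]_k :=
  \row_(i < k) (n%:R^-1 * \sum_(j < n) \1_(cell c i) (x j)).

End grouped_data.

Section divergence.
Context {R : realType}.
Local Open Scope ereal_scope.

(* phi : [0, +oo[ -> R `|` {+oo}; its values at negative reals are ignored. *)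
Definition divergence_function (phi : R -> \bar R) : Prop :=
  [/\ forall x : R, (0 <= x)%R -> phi x != -oo,
      {within `[0%R, +oo[, continuous phi},
      (forall x y t : R, (0 <= x)%R -> (0 <= y)%R -> (0 <= t <= 1)%R ->
         phi (t * x + (1 - t) * y)%R <= t%:E * phi x + (1 - t)%:E * phi y) &
      phi 1%R = 0].

Definition divergence_term (phi : R -> \bar R) (p q : R) : \bar R :=
  if q == 0%R then
    if p == 0%R then 0
    else p%:E * lim (phi u * (u^-1)%:E @[u --> +oo%R])
  else q%:E * phi (p / q)%R.

Definition phi_divergence (phi : R -> \bar R) (k : nat) (p q : 'rV[R]_k) :
    \bar R :=
  \sum_(i < k) divergence_term phi (p 0%R i) (q 0%R i).

End divergence.

Section inequality_indices.
Context {R : realType}.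

Definition qZ (Q : R -> R) (p : R) : R :=
  if (p == 0) || (p == 1) then 1 else 1 - Q (p / 2) / Q ((1 + p) / 2).

Definition qD (Q : R -> R) (p : R) : R :=
  if p == 0 then 1 else if p == 1 then 0 else 1 - Q (p / 2) / Q (1 - p / 2).

Definition qZI (Q : R -> R) : R :=
  \int[lebesgue_measure]_(p in `[0, 1]) qZ Q p.

Definition qDI (Q : R -> R) : R :=
  \int[lebesgue_measure]_(p in `[0, 1]) qD Q p.

End inequality_indices.

Section estimators.
Context {R : realType} {d} {T : measurableType d} (P : probability T R).
Context {s k : nat} (Theta : set 'rV[R]_s) (g : 'rV[R]_s -> 'rV[R]_k).

(* D j w is the index of the cell containing X j w.  An estimator at sample
   size n is a function of the n observed cells, hence a discrete random
   vector; no measurability condition is needed. *)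
Definition minimum_phi_divergence_estimator (phi : R -> \bar R)
    (c : nat -> \bar R) (X : nat -> T -> R) (D : nat -> T -> 'I_k)
    (theta_hat : nat -> T -> 'rV[R]_s) : Prop :=
  forall n, (0 < n)%N ->
    (exists est : n.-tuple 'I_k -> 'rV[R]_s,
       forall w, theta_hat n w = est [tuple D j w | j < n]) /\
    forall w, let p := frequencies k c n (X ^~ w) in
      Theta (theta_hat n w) /\
      forall t, Theta t ->
        (phi_divergence phi p (g (theta_hat n w)) <=
         phi_divergence phi p (g t))%E.

Definition BAN (theta0 : 'rV[R]_s) (theta_hat : nat -> T -> 'rV[R]_s) : Prop :=
  exists2 mu : probability (borel_rV s) R,
    is_multinormal mu 0 (invmx (fisher_information g theta0)) &
    cvg_in_distribution_rV P
      (fun n w => Num.sqrt n%:R *: (theta_hat n w - theta0)) mu.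

End estimators.

(* Main.v *)
Require Import Defs.
From HB Require Import structures.
From mathcomp Require Import all_boot all_order all_algebra.
From mathcomp Require Import all_classical all_reals all_analysis.
From mathcomp Require Import measurable_realfun.
Set Implicit Arguments.
Unset Strict Implicit.
Unset Printing Implicit Defensive.
Import Order.TTheory GRing.Theory Num.Theory.
Import numFieldNormedType.Exports.
Local Open Scope classical_set_scope.
Local Open Scope ring_scope.

(** The estimator is asymptotically normal by hypothesis, so the theorem is an
    instance of the delta method applied to v1 and v2 at the true parameter.

    The delta method itself is reduced to an extended continuous mapping
    theorem.  With the rescaled estimation error Yn = sqrt n (X n - t) one has
    sqrt n (v (X n) - v t) = h n (Yn), where
    h n y = sqrt n (v (t + y / sqrt n) - v t).  Differentiability at t says
    that h n y' tends to the differential of v at y, jointly in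
    n --> oo and y' --> y ([rescaled_increment_cvg]).  Such joint convergence
    is locally uniform, hence uniform on closed balls, which are compact; a
    single probability measure on R^s gives little mass to the complement of a
    large ball ([probability_rV_tight]), and a continuous cutoff function
    transfers this to the laws of Yn for large n.  Outside an event of small
    probability h n (Yn) is thus close to the differential applied to Yn, and
    [extended_continuous_mapping] follows.  The differential is the linear form
    y |-> y (grad v t)^T, and the law of a linear form under a multinormal law
    is known by definition ([integral_multinormal]).

    What is left is that sqrt n (v (X n) - v t) is a random variable for an
    arbitrary function v: the estimator depends on the sample only through the
    finitely many possible lists of observed cells, each of which is an event
    ([measurable_fun_fin_factor]). *)

(** * Measurability of functions of the observed cells *)

Lemma cell_disjoint (R : realType) (k : nat) (c : nat -> \bar R) (i j : 'I_k)
    (x : R) : is_partition k c -> cell c i x -> cell c j x -> i = j.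
Proof.
move=> [_ _ cS].
have cD (a : nat) m : (a + m <= k)%N -> (c a <= c (a + m)%N)%E.
  elim: m => [|m IH]; first by rewrite addn0.
  rewrite addnS => amk; apply: (le_trans (IH (ltnW amk))).
  exact/ltW/cS.
have cle (a b : nat) : (a <= b)%N -> (b <= k)%N -> (c a <= c b)%E.
  by move=> ab bk; rewrite -(subnKC ab); apply: cD; rewrite subnKC.
move=> /andP[ix xi] /andP[jx xj]; apply/val_inj/eqP; rewrite eqn_leq /=.
apply/andP; split; rewrite leqNgt; apply/negP => ij.
  have := lt_le_trans xj (le_trans (cle _ _ ij (ltnW (ltn_ord i))) ix).
  by rewrite ltxx.
have := lt_le_trans xi (le_trans (cle _ _ ij (ltnW (ltn_ord j))) jx).
by rewrite ltxx.
Qed.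

Lemma measurable_cell (R : realType) (c : nat -> \bar R) (i : nat) :
  measurable (cell c i).
Proof.
have -> : cell c i = EFin @^-1` `[c i, c i.+1[%classic.
  by apply/seteqP; split => x; rewrite /cell /= in_itv.
rewrite -[X in measurable X]setTI; apply: EFin_measurable => //.
exact: emeasurable_itv.
Qed.

(** A preimage under f \o D is a finite union of fibers of D. *)
Lemma measurable_fun_fin_factor d d' (T : measurableType d)
    (U : measurableType d') (I : finType) (D : T -> I) (f : I -> U) :
  (forall i, measurable (D @^-1` [set i])) ->
  measurable_fun setT (f \o D).
Proof.
move=> mD _ B mB; rewrite setTI.
have -> : (f \o D) @^-1` B = \bigcup_(i in f @^-1` B) (D @^-1` [set i]).
  by apply/seteqP; split => [w Bw|w [i Bi /= Di]]; [exists (D w)|rewrite /= Di].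
exact: fin_bigcup_measurable.
Qed.

(** The cells are pairwise disjoint, so that membership in a cell determines its
    index and the event that the index is i is the event that X falls in cell i. *)
Lemma measurable_cell_index d (T : measurableType d) (R : realType)
    (P : probability T R) (k : nat) (c : nat -> \bar R) (X : {RV P >-> R})
    (D : T -> 'I_k) (i : 'I_k) :
  is_partition k c -> (forall w, cell c (D w) (X w)) ->
  measurable (D @^-1` [set i]).
Proof.
move=> partc XD.
have -> : D @^-1` [set i] = X @^-1` cell c i.
  apply/seteqP; split => [w /= <-|w /= cw]; first exact: XD.
  exact: cell_disjoint partc (XD w) cw.
by rewrite -[X in measurable X]setTI; apply: measurable_funP => //; exact: measurable_cell.
Qed.

Lemma measurable_tuple_fiber d (T : measurableType d) (I : finType) (n : nat)
    (D : nat -> T -> I) (t : n.-tuple I) :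
  (forall j i, measurable (D j @^-1` [set i])) ->
  measurable ((fun w => [tuple D j w | j < n]) @^-1` [set t]).
Proof.
move=> mD.
have -> : (fun w => [tuple D j w | j < n]) @^-1` [set t] =
    \bigcap_(j in [set: 'I_n]) (D j @^-1` [set tnth t j]).
  apply/seteqP; split => [w /= <- j _ /=|w /= tw]; first by rewrite tnth_mktuple.
  by apply: eq_from_tnth => j; rewrite tnth_mktuple tw.
apply: fin_bigcap_measurable => //.
Qed.

(** * Linear forms of multinormal vectors *)

Lemma continuous_measurable_rV (R : realType) s (h : 'rV[R]_s -> R) :
  continuous h -> measurable_fun setT (h : @borel_rV R s -> R).
Proof.
move=> ch.
apply: (measurability _ (RGenOInfty.measurableE R)).
move=> _ [_ [a ->] <-]; rewrite setTI.
apply: sub_sigma_algebra.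
by apply: open_comp => [x _|]; [exact: ch|exact: interval_open].
Qed.

Lemma integrable_bounded d (T : measurableType d) (R : realType)
    (P : probability T R) (Y : T -> R) (M : R) :
  measurable_fun setT Y -> (forall w, `|Y w| <= M) ->
  P.-integrable setT (EFin \o Y).
Proof.
move=> mY YM; apply: measurable_bounded_integrable => //.
  exact: le_lt_trans (probability_le1 P measurableT) (ltry 1).
by exists M; split => [|x Mx w _]; [exact: num_real|exact: le_trans (YM w) (ltW Mx)].
Qed.

Lemma continuous_rowdot (R : realType) s (u : 'rV[R]_s) :
  continuous (fun x : 'rV[R]_s => (x *m u^T) 0 0 : R).
Proof.
have -> : (fun x : 'rV[R]_s => (x *m u^T) 0 0 : R) =
    (fun x : 'rV[R]_s => \sum_j x 0 j * u 0 j).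
  by apply/funext => y; rewrite mxE; under eq_bigr do rewrite [u^T _ _]mxE.
apply: (continuous_big add_continuous) => j _ x.
exact: (cvgMr_tmp (FF := nbhs_filter x) (@coord_continuous R 1 s 0 j x)).
Qed.

(** The normal law is given as a measure on the sigma-algebra generated by the
    half-open intervals.  Its restatement on the canonical measurable structure
    of the reals is a different type, although the measurable sets coincide. *)
Section normal_measure.
Context {R : realType} (m s : R).
Let nu : {measure set (measurableTypeR R) -> \bar R} := normal_prob m s.

Definition borel_normal : set R -> \bar R := normal_prob m s.

Let borel_normal0 : borel_normal set0 = 0%E.
Proof. exact: (measure0 nu). Qed.

Let borel_normal_ge0 A : (0 <= borel_normal A)%E.
Proof. exact: (measure_ge0 nu). Qed.

Let borel_normal_sigma_additive : semi_sigma_additive borel_normal.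
Proof. by move=> F; exact: (@measure_semi_sigma_additive _ _ _ nu F). Qed.

HB.instance Definition _ := isMeasure.Build _ _ _ borel_normal
  borel_normal0 borel_normal_ge0 borel_normal_sigma_additive.

End normal_measure.

(** The left-hand side is the integral with respect to the image of mu under the
    linear form x |-> x u^T. *)
Lemma integral_multinormal (R : realType) s
    (mu : probability (@borel_rV R s) R) (m : 'rV[R]_s) (S : 'M[R]_s)
    (u : 'rV[R]_s) (f : R -> R) :
  is_multinormal mu m S -> continuous f -> (exists M, forall x, `|f x| <= M) ->
  (\int[normal_law ((m *m u^T) 0 0)%R ((u *m S *m u^T) 0 0)%R]_x (f x)%:E =
   \int[mu]_x (f ((x *m u^T) 0 0)%R)%:E)%E.
Proof.
move=> mun cf [M fM].
pose H (x : @borel_rV R s) : R := (x *m u^T) 0 0.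
have mH : measurable_fun setT H.
  exact: (continuous_measurable_rV (@continuous_rowdot R s u)).
have mf : measurable_fun setT f by exact: continuous_measurable_fun.
rewrite -(@integral_pushforward _ _ (@borel_rV R s) R _ H mH mu setT (EFin \o f)) //; last 2 first.
- exact/measurable_EFinP.
- rewrite preimage_setT -compA; apply: (@integrable_bounded _ _ _ mu (f \o H) M).
    exact: measurableT_comp.
  by move=> w; exact: fM.
pose nu : {measure set R -> \bar R} :=
  measure_function_pushforward__canonical__measure_function_Measure mu mH.
have -> : (\int[pushforward mu H]_y (EFin \o f) y = \int[nu]_y (f y)%:E)%E by [].
rewrite /normal_law; case: ifPn => v0.
  apply: eq_measure_integral => A mA _ /=.
  by have := mun u A mA; rewrite /normal_law v0.
apply: (@eq_measure_integral _ _ R setT nu (borel_normal _ _)) => A mA _ /=.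
by have := mun u A mA; rewrite /normal_law (negbTE v0).
Qed.

(** * The extended continuous mapping theorem *)

Lemma expectationE_Rintegral d (T : measurableType d) (R : realType)
    (P : probability T R) (Y : T -> R) :
  P.-integrable setT (EFin \o Y) -> 'E_P[Y]%E = (\int[P]_w Y w)%:E.
Proof.
move=> iY; rewrite unlock /Rintegral fineK//.
exact: integrable_fin_num iY.
Qed.

(** A continuous stand-in for the indicator of the complement of the ball of
    radius K: it vanishes on that ball and is 1 outside the ball of radius
    K + 1.  Continuity is what lets it be tested against convergence in
    distribution. *)
Definition cutoff (R : realType) (s : nat) (K : R) (y : 'rV[R]_s) : R :=
  Num.min 1 (Num.max 0 (`|y| - K)).

Lemma continuous_cutoff (R : realType) s (K : R) :
  continuous (@cutoff R s K).
Proof.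
move=> y.
apply: (@continuous_min R _ (cst 1) (fun y => Num.max 0 (`|y| - K)) y).
  exact: cst_continuous.
apply: (@continuous_max R _ (cst 0) (fun y => `|y| - K) y).
  exact: cst_continuous.
apply: continuousB; [exact: norm_continuous|exact: cst_continuous].
Qed.

Lemma cutoff_ge0 (R : realType) s (K : R) (y : 'rV[R]_s) : 0 <= cutoff K y.
Proof. by rewrite /cutoff le_min ler01 le_max lexx. Qed.

Lemma cutoff_le1 (R : realType) s (K : R) (y : 'rV[R]_s) : cutoff K y <= 1.
Proof. by rewrite /cutoff ge_min lexx. Qed.

Lemma normr_cutoff_le1 (R : realType) s (K : R) (y : 'rV[R]_s) :
  `|cutoff K y| <= 1.
Proof. by rewrite ger0_norm ?cutoff_ge0 ?cutoff_le1. Qed.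

(** The cutoffs at 0, 1, 2, ... converge pointwise to 0 and are bounded by 1, so
    dominated convergence applies. *)
Lemma probability_rV_tight (R : realType) s (mu : probability (@borel_rV R s) R) (e : R) :
  0 < e -> exists K : R, (\int[mu]_y (cutoff K y)%:E < e%:E)%E.
Proof.
move=> e0.
have mcut K : measurable_fun setT (cutoff K : @borel_rV R s -> R).
  exact: continuous_measurable_rV (@continuous_cutoff R s K).
have [] := @dominated_convergence _ (@borel_rV R s) R mu setT measurableT
   (fun n => EFin \o cutoff n%:R) (cst 0%E) (cst 1%E).
- by move=> n; exact/measurable_EFinP.
- exact: measurable_cst.
- apply: aeW => y _; apply: cvg_near_cst.
  near=> n.
  have yn : `|(y : 'rV[R]_s)| <= n%:R by near: n; exact: nbhs_infty_ger.
  by rewrite /= /cutoff max_l ?subr_le0// min_r.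
- apply: (@integrable_bounded _ _ _ mu (cst 1) 1) => // w.
  by rewrite normr1.
- apply: aeW => y n _; rewrite /= lee_fin; exact: normr_cutoff_le1.
move=> _ _; rewrite integral0 => /fine_cvgP[ffin].
move=> /cvgrPdist_lt/(_ e e0) cut.
near \oo => n; exists n%:R.
have fn : (\int[mu]_y (cutoff n%:R y)%:E \is a fin_num)%E by near: n; exact: ffin.
rewrite -(fineK fn) lte_fin; apply: le_lt_trans (ler_norm _) _.
rewrite -normrN -[X in `|X|]add0r.
by near: n.
Unshelve. all: by end_near. Qed.

(** The joint limit in [hH] is the usual requirement that h n (y n) --> H y
    whenever y n --> y.  For bounded f the difference between f (h n (Y n)) and
    f (H (Y n)) is uniformly small when Y n lies in a large ball, and is
    controlled by the cutoff otherwise. *)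
Lemma extended_continuous_mapping d (T : measurableType d) (R : realType)
    (P : probability T R) (s : nat) (Y : nat -> T -> 'rV[R]_s)
    (mu : probability (@borel_rV R s) R) (h : nat -> 'rV[R]_s -> R)
    (H : 'rV[R]_s -> R) :
  cvg_in_distribution_rV P Y mu ->
  continuous H ->
  (forall y, (fun p => h p.2 p.1) @ filter_prod (nbhs y) \oo --> H y) ->
  (forall n, measurable_fun setT (fun w => h n (Y n w))) ->
  forall f : R -> R, continuous f -> (exists M, forall x, `|f x| <= M) ->
    ('E_P[fun w => f (h n (Y n w))] @[n --> \oo] -->
     \int[mu]_y (f (H y))%:E)%E.
Proof.
move=> [mY cvgY] cH hH mh f cf [M fM].
have M0 : 0 <= M by apply: le_trans (fM 0).
have mcut K : measurable_fun setT (cutoff K : @borel_rV R s -> R).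
  exact: continuous_measurable_rV (@continuous_cutoff R s K).
have cfH : continuous (f \o H) by move=> y; apply: continuous_comp; [exact: cH|exact: cf].
have mfH : measurable_fun setT (f \o H : @borel_rV R s -> R).
  exact: continuous_measurable_rV.
have mf : measurable_fun setT f by exact: continuous_measurable_fun.
pose a n w := f (h n (Y n w)).
pose b n w := f (H (Y n w)).
have ia n : P.-integrable setT (EFin \o a n).
  apply: (@integrable_bounded _ _ _ _ _ M); last by move=> w; exact: fM.
  exact: (measurableT_comp mf (mh n)).
have ib n : P.-integrable setT (EFin \o b n).
  apply: (@integrable_bounded _ _ _ _ _ M); last by move=> w; exact: fM.
  exact: (measurableT_comp mfH (mY n)).
have ic K n : P.-integrable setT (EFin \o (fun w => cutoff K (Y n w))).
  apply: (@integrable_bounded _ _ _ _ _ 1); last by move=> w; exact: normr_cutoff_le1.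
  exact: (measurableT_comp (mcut K) (mY n)).
have imu : mu.-integrable setT (EFin \o (f \o H)).
  by apply: (@integrable_bounded _ _ _ _ _ M) => // y; exact: fM.
have lfin : (\int[mu]_y (f (H y))%:E \is a fin_num)%E by exact: integrable_fin_num imu.
rewrite -(fineK lfin).
under eq_cvg do rewrite (expectationE_Rintegral (ia _)).
have cvgb : \int[P]_w b n w @[n --> \oo] --> fine (\int[mu]_y (f (H y))%:E)%E.
  have : ('E_P[b n] @[n --> \oo] --> (fine (\int[mu]_y (f (H y))%:E))%:E)%E.
    by rewrite fineK//; apply: cvgY => //; exists M => y; exact: fM.
  under eq_cvg do rewrite (expectationE_Rintegral (ib _)).
  by move/fine_cvg.
apply: cvg_EFin; first exact: nearW.
apply/cvgrPdist_le => e e0.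
(* The error is a sum of e' (convergence of the law of H (Y n)), e' (uniform
   closeness on the ball) and 2 * M * e' (cutoff). *)
pose e' := e / (2 + 2 * M).
have M2 : 0 < 2 + 2 * M by rewrite ltr_pwDl// mulr_ge0.
have e'0 : 0 < e' by rewrite divr_gt0.
have [K Ke] := probability_rV_tight mu e'0.
have icut : mu.-integrable setT (EFin \o cutoff K).
  by apply: (@integrable_bounded _ _ _ _ _ 1) => // y; exact: normr_cutoff_le1.
have cutfin : (\int[mu]_y (cutoff K y)%:E \is a fin_num)%E.
  exact: integrable_fin_num icut.
have cvgc : \int[P]_w cutoff K (Y n w) @[n --> \oo] -->
    fine (\int[mu]_y (cutoff K y)%:E)%E.
  have : ('E_P[(fun w => cutoff K (Y n w))] @[n --> \oo] -->
      (fine (\int[mu]_y (cutoff K y)%:E))%:E)%E.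
    rewrite fineK//; apply: cvgY; first exact: continuous_cutoff.
    by exists 1 => y; exact: normr_cutoff_le1.
  under eq_cvg do rewrite (expectationE_Rintegral (ic K _)).
  by move/fine_cvg.
have cptB : compact [set y : 'rV[R]_s | `|y| <= K + 1].
  apply: bounded_closed_compact.
    exists (K + 1); split=> [|r Kr y /= yK]; first exact: num_real.
    exact: le_trans yK (ltW Kr).
  rewrite (_ : [set y | _] = (@Num.norm _ 'rV[R]_s) @^-1` [set x | x <= K + 1])//.
  apply: closed_comp => [y _|]; first exact: norm_continuous.
  exact: closed_le.
(* The compactness used is that of near coverings: joint convergence at each
   point of a compact set is uniform on it. *)
have unif : \forall n \near \oo, forall y : 'rV[R]_s, `|y| <= K + 1 ->
    `|f (h n y) - f (H y)| <= e'.
  apply: ((compact_near_coveringP _).1 cptB _ \oo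
    (fun n y => `|f (h n y) - f (H y)| <= e')) => y _.
  have e'2 : 0 < e' / 2 by rewrite divr_gt0.
  have fh : \forall p \near filter_prod (nbhs y) \oo,
      `|f (H y) - f (h p.2 p.1)| < e' / 2.
    have : f (h p.2 p.1) @[p --> filter_prod (nbhs y) \oo] --> f (H y).
      by apply: continuous_cvg; [exact: cf|exact: hH].
    by move=> /cvgrPdist_lt; exact.
  have fH : \forall p \near filter_prod (nbhs y) \oo,
      `|f (H y) - f (H p.1)| < e' / 2.
    apply: (@filter_prod1 _ _ (nbhs y) \oo _ (fun y' => `|f (H y) - f (H y')| < e' / 2)).
    by have /cvgrPdist_lt := cfH y; exact.
  apply: filterS2 fh fH => -[y' n] /= /ltW h1 /ltW h2.
  rewrite distrC in h1.
  have := le_trans (ler_distD (f (H y)) _ _) (lerD h1 h2).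
  by rewrite -splitr.
near=> n.
have un : forall y : 'rV[R]_s, `|y| <= K + 1 -> `|f (h n y) - f (H y)| <= e'.
  by near: n.
have cn : \int[P]_w cutoff K (Y n w) <= e'.
  near: n.
  have Ke' : fine (\int[mu]_y (cutoff K y)%:E) < e'.
    by rewrite -lte_fin fineK.
  by have /cvgr_le := cvgc; apply.
have bn : `|fine (\int[mu]_y (f (H y))%:E) - \int[P]_w b n w| <= e'.
  by near: n; move/cvgrPdist_le : cvgb; exact.
have key : `|\int[P]_w b n w - \int[P]_w a n w| <= e' + 2 * M * e'.
  have pw w : `|b n w - a n w| <= e' + 2 * M * cutoff K (Y n w).
    have [yK|Ky] := leP `|Y n w| (K + 1).
      rewrite distrC (le_trans (un _ yK))// lerDl.
      by rewrite !mulr_ge0// cutoff_ge0.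
    have -> : cutoff K (Y n w) = 1.
      rewrite /cutoff min_l// le_max; apply/orP; right.
      by rewrite lerBrDl ltW.
    rewrite mulr1 (le_trans (ler_normB _ _))//.
    rewrite mulrDl mul1r; apply: ler_wpDl; first exact: ltW.
    by rewrite lerD ?fM.
  rewrite -RintegralB//.
  have iba : P.-integrable setT (EFin \o (fun w => b n w - a n w)).
    by have := integrableB measurableT (ib n) (ia n).
  have iMc : P.-integrable setT (EFin \o (fun w => 2 * M * cutoff K (Y n w))).
    by have := integrableZl measurableT (2 * M) (ic K n).
  have ie : P.-integrable setT (EFin \o (fun=> e') : T -> \bar R).
    exact: finite_measure_integrable_cst.
  apply: (le_trans (le_normr_Rintegral measurableT iba)).
  apply: (@le_trans _ _ (\int[P]_w (e' + 2 * M * cutoff K (Y n w)))%R).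
    apply: le_Rintegral => //.
      exact: integrable_norm.
    by have := integrableD measurableT ie iMc.
  rewrite RintegralD// Rintegral_cst//.
  have -> : fine (P [set: T]) = 1 by have /= -> := @probability_setT _ _ _ P.
  rewrite mulr1 lerD2l.
  by rewrite RintegralZl// ler_wpM2l ?mulr_ge0//.
rewrite (le_trans (ler_distD (\int[P]_w b n w) _ _))//.
apply: le_trans (lerD bn key) _.
rewrite -[leRHS](divfK (lt0r_neq0 M2)) -/e' mulrDr mulr_natr mulr2n -addrA.
by rewrite [X in _ <= _ + (_ + X)]mulrC.
Unshelve. all: by end_near. Qed.

(** * The delta method *)

Lemma diff_grad (R : realType) s (v : 'rV[R]_s -> R) (t : 'rV[R]_s) y :
  differentiable v t -> 'd v t y = (y *m (grad v t)^T) 0 0.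
Proof.
move=> dv; rewrite [in LHS](row_sum_delta y) linear_sum mxE.
apply: eq_bigr => j _.
by rewrite linearZ [(grad v t)^T _ _]mxE [grad v t _ _]mxE /partial deriveE.
Qed.

(** The remainder of the first-order expansion at y' / r n is, for large n,
    at most e * |y'| / r n, so multiplying it by r n leaves e * |y'|, which is small
    uniformly for y' near y. *)
Lemma rescaled_increment_cvg (R : realType) (s : nat) (v : 'rV[R]_s -> R)
    (t : 'rV[R]_s) (r : nat -> R) (y : 'rV[R]_s) :
  differentiable v t -> r n @[n --> \oo] --> +oo ->
  (fun p : 'rV[R]_s * nat => r p.2 * (v (t + (r p.2)^-1 *: p.1) - v t))
    @ filter_prod (nbhs y) \oo --> ('d v t y : R).
Proof.
move=> dv roo.
have rP : \forall p \near filter_prod (nbhs y) \oo, 0 < r p.2.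
  apply: (@filter_prod2 _ _ (nbhs y) \oo _ (fun n => 0 < r n)).
  by have /cvgryPgt := roo; exact.
have cy : p.1 @[p --> filter_prod (nbhs y) \oo] --> y by exact: cvg_fst.
have cr : (r p.2)^-1 @[p --> filter_prod (nbhs y) \oo] --> (0 : R).
  apply/(gtr0_cvgV0 rP).
  exact: (@cvg_comp _ _ _ snd r _ _ _ cvg_snd roo).
have c0 : (r p.2)^-1 *: p.1 @[p --> filter_prod (nbhs y) \oo] --> (0 : 'rV[R]_s).
  by rewrite -(scale0r y); apply: cvgZ.
have cd : 'd v t p.1 @[p --> filter_prod (nbhs y) \oo] --> ('d v t y : R).
  by apply: continuous_cvg => //; exact: diff_continuous.
have small : (fun p : 'rV[R]_s * nat => r p.2 * (v (t + (r p.2)^-1 *: p.1) - v t) - 'd v t p.1)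
    @ filter_prod (nbhs y) \oo --> (0 : R).
  apply/cvgr0Pnorm_le => e e0.
  (* B bounds |y'| for y' near y. *)
  pose B := `|y| + 1.
  have B0 : 0 < B by rewrite ltr_wpDl.
  have bd : \forall p \near filter_prod (nbhs y) \oo, `|p.1| <= B.
    apply: (@filter_prod1 _ _ (nbhs y) \oo _ (fun y' : 'rV[R]_s => `|y'| <= B)).
    have /cvgr_norm_le := @cvg_id _ (nbhs y); apply.
    by rewrite /B ltrDl.
  have lo : \forall h \near (0 : 'rV[R]_s), `|v (h + t) - v t - 'd v t h| <= e / B * `|h|.
    have /eqaddoP := diff_locally dv.
    move=> /(_ (e / B) (divr_gt0 e0 B0)); apply: filterS => h /=.
    by rewrite /= opprD addrA.
  have lop := c0 _ lo.
  apply: filterS3 rP bd lop => -[y' n] /= rn yB loh.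
  have -> : r n * (v (t + (r n)^-1 *: y') - v t) - 'd v t y' =
      r n * (v ((r n)^-1 *: y' + t) - v t - 'd v t ((r n)^-1 *: y')).
    by rewrite linearZ /= [in RHS]mulrBr mulVKf ?gt_eqF// [t + _]addrC.
  rewrite normrM (gtr0_norm rn).
  apply: le_trans (ler_wpM2l (ltW rn) loh) _.
  rewrite normrZ normfV (gtr0_norm rn) mulrCA mulVKf ?gt_eqF//.
  by rewrite mulrAC ler_pdivrMr// ler_wpM2l// ltW.
rewrite -[X in _ --> X]add0r.
have -> : (fun p : 'rV[R]_s * nat => r p.2 * (v (t + (r p.2)^-1 *: p.1) - v t)) =
   (fun p => r p.2 * (v (t + (r p.2)^-1 *: p.1) - v t) - 'd v t p.1) \+ (fun p => 'd v t p.1).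
  by apply/funext => p /=; rewrite subrK.
exact: cvgD.
Qed.

(** The limit law is written for multinormal limits; S may be singular, in which
    case the limit variance may be 0.  Measurability of the rescaled increments
    is assumed since differentiability at a single point does not provide it. *)
Theorem delta_method d (T : measurableType d) (R : realType)
    (P : probability T R) (s : nat) (X : nat -> T -> 'rV[R]_s)
    (t : 'rV[R]_s) (r : nat -> R) (v : 'rV[R]_s -> R)
    (mu : probability (@borel_rV R s) R) (S : 'M[R]_s) :
  r n @[n --> \oo] --> +oo ->
  cvg_in_distribution_rV P (fun n w => r n *: (X n w - t)) mu ->
  is_multinormal mu 0 S ->
  differentiable v t ->
  (forall n, measurable_fun setT (fun w => r n * (v (X n w) - v t))) ->
  cvg_in_distribution P (fun n w => r n * (v (X n w) - v t))
    (normal_law 0 ((grad v t *m S *m (grad v t)^T) 0 0)).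
Proof.
move=> roo cX muN dv mv; split=> // f cf bf.
have := integral_multinormal (grad v t) muN cf bf.
rewrite mul0mx mxE => ->.
have -> : (\int[mu]_x (f ((x *m (grad v t)^T) 0 0)%R)%:E =
    \int[mu]_x (f ('d v t x))%:E)%E.
  by apply: eq_integral => x _; rewrite diff_grad.
pose h n (y : 'rV[R]_s) : R := r n * (v (t + (r n)^-1 *: y) - v t).
have hE n w : h n (r n *: (X n w - t)) = r n * (v (X n w) - v t).
  (* Where r n = 0 both sides vanish, whatever the value of X n. *)
  rewrite /h; have [->|r0] := eqVneq (r n) 0; first by rewrite !mul0r.
  by rewrite scalerA mulVf// scale1r subrKC.
have mh n : measurable_fun setT (fun w => h n (r n *: (X n w - t))).
  by under eq_fun do rewrite hE; exact: mv.
have := extended_continuous_mapping cX (diff_continuous dv) _ mh cf bf.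
under [X in (_ -> X) -> _]eq_cvg do under eq_fun do rewrite hE.
apply=> y; exact: rescaled_increment_cvg.
Qed.

(** * Asymptotic normality of the indices *)

Lemma cvg_sqrtn (R : realType) : Num.sqrt (n%:R : R) @[n --> \oo] --> +oo.
Proof.
apply/cvgryPge => A; near=> n.
apply: le_trans (ler_norm A) _; rewrite -sqrtr_sqr ler_wsqrtr//.
by near: n; exact: nbhs_infty_ger.
Unshelve. all: by end_near. Qed.

Theorem theorem3p8 (R : realType) (d : measure_display) (T : measurableType d)
    (P : probability T R) (s k : nat) (Theta : set 'rV[R]_s)
    (F : 'rV[R]_s -> R -> R) (theta0 : 'rV[R]_s) (c : nat -> \bar R)
    (X : nat -> {RV P >-> R}) (D : nat -> T -> 'I_k)
    (g := fun t => cell_probs k c (F t))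
    (phi : R -> \bar R) (theta_hat : nat -> T -> 'rV[R]_s)
    (sk : (s + 1 < k)%N)
    (partc : is_partition k c)
    (cdfF : forall t, Theta t -> is_cdf (F t))
    (X_ge0 : forall j w, 0 <= X j w)
    (X_cdf : forall j x, cdf (X j) x = (F theta0 x)%:E)
    (X_indep : mutually_independent X)
    (D_cell : forall j w, cell c (D j w) (X j w))
    (A1 : forall t, Theta t ->
       [/\ absolutely_continuous_on `[0, +oo[%classic (F t),
           {in `[0, +oo[ &, {homo F t : x y / x < y}} & F t 0 = 0])
    (A2 : Theta° theta0 /\ compact Theta)
    (A3 : forall p : R, 0 < p < 1 ->
       {within Theta, continuous (fun t => quantile (F t) p)})
    (B1 : forall i, 0 < g theta0 0 i)
    (B2 : differentiable g theta0)
    (B3 : \rank (jac g theta0) = s)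
    (B4 : set_inj Theta g /\
       pinv Theta g y @[y --> within (g @` Theta) (nbhs (g theta0))]
         --> pinv Theta g (g theta0))
    (B5 : {within Theta, continuous g})
    (B6 : continuous_second_partials g theta0)
    (phiP : divergence_function phi)
    (mde : minimum_phi_divergence_estimator Theta g phi c X D theta_hat)
    (ban : BAN P g theta0 theta_hat)
    (v1 := fun t => qZI (quantile (F t)))
    (v2 := fun t => qDI (quantile (F t))) :
  (differentiable v1 theta0 -> grad v1 theta0 != 0 ->
   cvg_in_distribution P
     (fun n w => Num.sqrt n%:R * (v1 (theta_hat n w) - v1 theta0))
     (normal_law 0 ((grad v1 theta0 *m invmx (fisher_information g theta0)
                     *m (grad v1 theta0)^T) 0 0))) /\
  (differentiable v2 theta0 -> grad v2 theta0 != 0 ->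
   cvg_in_distribution P
     (fun n w => Num.sqrt n%:R * (v2 (theta_hat n w) - v2 theta0))
     (normal_law 0 ((grad v2 theta0 *m invmx (fisher_information g theta0)
                     *m (grad v2 theta0)^T) 0 0))).
Proof.
have delta (v : 'rV[R]_s -> R) : differentiable v theta0 ->
    cvg_in_distribution P
      (fun n w => Num.sqrt n%:R * (v (theta_hat n w) - v theta0))
      (normal_law 0 ((grad v theta0 *m invmx (fisher_information g theta0)
                      *m (grad v theta0)^T) 0 0)).
  move=> dv; have [mu muN cvg_mu] := ban.
  apply: delta_method cvg_mu muN dv _; first exact: cvg_sqrtn.
  (* The estimator is only constrained for nonempty samples; at n = 0 the
     rescaled error is the constant 0. *)
  case=> [|n].
    by under eq_fun do rewrite sqrtr0 mul0r; exact: measurable_cst.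
  have [[est hatE] _] := mde n.+1 isT.
  under eq_fun do rewrite hatE.
  apply: (@measurable_fun_fin_factor _ _ T R _
    (fun w => [tuple D j w | j < n.+1])
    (fun t => Num.sqrt n.+1%:R * (v (est t) - v theta0))) => t.
  apply: measurable_tuple_fiber => j i.
  exact: measurable_cell_index partc (D_cell j).
by split=> dv _; exact: delta.
Qed.
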